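(* Let $C$ be a nonempty closed convex subset of $X$, let $F\colon X\to Y\cup\{+\infty_Y\}$ be a proper $K$-convex mapping such that $y^*\circ F$ is lower semicontinuous for all $y^*\in Y^*$, and let $G\colon X\to Z\cup\{+\infty_Z\}$ be a proper $S$-convex and $S$-epi closed mapping. Let $A:=C\cap G^{-1}(-S)$ and assume that $A\cap\operatorname{dom}F\neq\emptyset$. Then $$\operatorname{epi}_K(F+I_A)^*=\operatorname{cl}\Big[\bigcup_{T\in\mathcal{L}_+(S,K)}\operatorname{epi}_K(F+I_C+T\circ G)^*\Big],$$ the closure being taken in $\mathcal{L}(X,Y)\times Y$.
   Context: $X,Y,Z$ are (real) locally convex Hausdorff topological vector spaces with topological duals $X^*,Y^*,Z^*$; $K\subset Y$ is a closed, pointed, convex cone with $\operatorname{int}K\neq\emptyset$; $S\subset Z$ is a nonempty closed convex cone. Order and infinite elements: for $y_1,y_2\in Y$, $y_1<_K y_2$ means $y_1-y_2\in-\operatorname{int}K$. $Y^\bullet:=Y\cup\{-\infty_Y,+\infty_Y\}$, where $\pm\infty_Y\notin Y$ and $-\infty_Y<_K y<_K+\infty_Y$ for all $y\in Y$ (hence also $-\infty_Y<_K+\infty_Y$). Conventions: $-(+\infty_Y)=-\infty_Y$, $-(-\infty_Y)=+\infty_Y$, $(+\infty_Y)+y=y+(+\infty_Y)=+\infty_Y$ for $y\in Y\cup\{+\infty_Y\}$, $(-\infty_Y)+y=y+(-\infty_Y)=-\infty_Y$ for $y\in Y\cup\{-\infty_Y\}$. Analogous elements $\pm\infty_Z$ and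 conventions are used for $Z$ (ordered by $S$). Weak supremum: for $\emptyset\neq M\subset Y^\bullet$, $\operatorname{WSup}M$ is the set of $\bar v\in Y^\bullet$ such that $\bar v\not<_K v$ for all $v\in M$, and for every $\tilde v\in Y^\bullet$ with $\tilde v<_K\bar v$ there is $v\in M$ with $\tilde v<_K v$. Mappings: for $F\colon X\to Y^\bullet$, $\operatorname{dom}F=\{x\in X: F(x)\neq+\infty_Y\}$; $F$ is proper if $\operatorname{dom}F\neq\emptyset$ and $-\infty_Y\notin F(X)$; $\operatorname{epi}_KF=\{(x,y)\in X\times Y: y\in F(x)+K\}$; $F$ is $K$-convex if $\operatorname{epi}_KF$ is convex, and $K$-epi closed if it is closed. The same notions are used for $G$ with $(Z,S)$ in place of $(Y,K)$. For $y^*\in Y^*$, $(y^*\circ F)(x)=y^*(F(x))$ if $F(x)\in Y$ and $+\infty$ if $F(x)=+\infty_Y$. $\mathcal{L}(X,Y)$ is the space of continuous linear mappings $X\to Y$ with the topology of pointwise convergence. The conjugate of $F$ is the set-valued map $F^*(L)=\operatorname{WSup}\{L(x)-F(x):x\in X\}$, $L\in\mathcal{L}(X,Y)$, and $\operatorname{epi}_KF^*=\{(L,y)\in\mathcal{L}(X,Y)\times Y: y\in F^*(L)+K\}$. For $D\subset X$, $I_D(x)=0_Y$ if $x\in D$ and $I_D(x)=+\infty_Y$ otherwise. For $T\in\mathcal{L}(Z,Y)$, $(T\circ G)(x)=T(G(x))$ if $G(x)\in Z$ and $+\infty_Y$ if $G(x)=+\infty_Z$. $\mathcal{L}_+(S,K)=\{T\in\mathcal{L}(Z,Y):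 T(S)\subset K\}$. *)

(* Defs.v *)
From HB Require Import structures.
From mathcomp Require Import all_boot all_order all_algebra.
From mathcomp Require Import all_classical all_reals all_analysis.

Set Implicit Arguments.
Unset Strict Implicit.
Unset Printing Implicit Defensive.

Import Order.TTheory GRing.Theory Num.Theory.
Import numFieldNormedType.Exports.

Local Open Scope classical_set_scope.
Local Open Scope ring_scope.
Local Open Scope ereal_scope.

(* [Y] completed by two infinite elements is [\bar Y]: the library type, with
   its negation and addition, makes sense over any abelian group. Its addition
   also sets [+oo + -oo = -oo]; that case is undefined in the mathematics, and
   never arises below for mappings that do not take the value [-oo]. *)

Section ContinuousLinearMaps.
Variable R : realType.

Definition contlin (X Y : tvsType R) : Type :=
  set_type [set f : {ptws X -> Y} | linear (f : X -> Y) /\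
                                    continuous (f : X -> Y)].

(* The subtype topology inherited from [{ptws X -> Y}], that is, the topology of
   pointwise convergence. *)
HB.instance Definition _ (X Y : tvsType R) :=
  Topological.copy (contlin X Y)
    (set_type [set f : {ptws X -> Y} | linear (f : X -> Y) /\
                                       continuous (f : X -> Y)]).

Definition contlin_fun (X Y : tvsType R) (L : contlin X Y) : X -> Y :=
  set_val L.

End ContinuousLinearMaps.

Coercion contlin_fun : contlin >-> Funclass.

Section Cones.
Variables (R : realType) (V : lmodType R).

(* Whether [t = 0] is allowed is immaterial for a nonempty closed set. *)
Definition is_cone (K : set V) := forall t x, (0 < t)%R -> K x -> K (t *: x).

Definition pointed_cone (K : set V) := K `&` (-%R @` K) = [set 0%R].

End Cones.

Section WeakOrder.
Variables (R : realType) (Y : tvsType R) (K : set Y).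

Definition lt_cone (u v : \bar Y) : Prop :=
  match u, v with
  | a%:E, b%:E => (-%R @` K°) (a - b)%R
  | -oo, _%:E | -oo, +oo | _%:E, +oo => True
  | _, _ => False
  end.

Definition WSup (M : set (\bar Y)) : set (\bar Y) :=
  [set v' | (forall v, M v -> ~ lt_cone v' v) /\
            (forall u, lt_cone u v' -> exists2 v, M v & lt_cone u v)].

End WeakOrder.

Section Mappings.
Variables (R : realType) (X Y : tvsType R).
Implicit Types F : X -> \bar Y.

Definition edom F : set X := [set x | F x <> +oo].

Definition proper_map F := edom F !=set0 /\ ~ range F -oo.

Definition epi (K : set Y) F : set (X * Y) :=
  [set p | [set F p.1 + k%:E | k in K] p.2%:E].

Definition K_convex (K : set Y) F := @convex_set R (X * Y)%type (epi K F).

Definition K_epi_closed (K : set Y) F := closed (epi K F).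

Definition indic_map (D : set X) : X -> \bar Y :=
  fun x => if x \in D then 0%R%:E else +oo.

Definition conj_map (K : set Y) F : contlin X Y -> set (\bar Y) :=
  fun L => WSup K [set (L x)%:E - F x | x in [set: X]].

Definition epi_conj (K : set Y) F : set (contlin X Y * Y) :=
  [set p | [set v + k%:E | v in conj_map K F p.1 & k in K] p.2%:E].

End Mappings.

Arguments indic_map {R X} Y D.

Definition Lplus (R : realType) (Z Y : tvsType R) (S : set Z) (K : set Y) :
  set (contlin Z Y) := [set T | T @` S `<=` K].

(* Main.v *)
From HB Require Import structures.
Require Import Defs.
From mathcomp Require Import all_boot all_order all_algebra.
From mathcomp Require Import all_classical all_reals all_analysis.
From mathcomp Require Import ring lra.

(** Write [A] for the feasible set. For a proper mapping [H], a pair [(L, y)]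
lies in the conjugate epigraph of [H] exactly when no value
[L x - H x - y] with [H x] finite is interior to [K] ([epi_conjP]): moving [y]
down along an interior direction of [K] until the condition is about to fail
produces the point of the weak supremum that lies below [y]. Both sides of the
equality thereby become statements about pointwise inequalities.

Weak duality gives one inclusion: on [A] the term [T (G x)] lies in [- K], so
each set of the union is contained in the conjugate epigraph of [F + I_A]; the
latter is closed, being cut out by conditions each of which involves only [y]
and the value of [L] at a single point ([closed_epi_conj]).

For the other inclusion, let [(L, y)] be in the conjugate epigraph of [F + I_A].
The convex set of all points above some [F x - L x + y], [x] in [A], misses
[- int K], so a functional [f] separates them ([cone_separation]), and
[f (F x - L x + y) >= 0] for [x] in [A]. Consider in [X * Z * R] the set [E] of
all [((x, z), r)] with [x] in [C], [z] in [G x + S] and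
[r >= f (F x - L x + y)]. It is convex, it is closed because [f] composed with
[F] is lower semicontinuous and the epigraph of [G] is closed, and it lies above
height [0] over the subspace [z = 0]. A perturbed Hahn-Banach argument
([approx_minorant]) gives a functional [phi] on [X * Z], arbitrarily small at
finitely many prescribed points [(x, 0)], and such that [- phi - d] minorizes [E].
Its [Z]-part is nonnegative on [S]. Choose [e] interior to [K] with [f e = 1];
then multiplication by [e] turns the scalar objects into vector ones:
[T z = phi (0, z) e] is a multiplier, and [L - phi (., 0) e] and [y + d e] are
as close to [L] and [y] as desired in the topology of pointwise convergence.

The perturbed argument is an ordinary strict separation: before separating
[(0, - d)] from [E], the set [E] is thickened by long segments in the prescribed
directions. The thickened set is still closed and convex and still misses
[(0, - d)], and a functional that is bounded below on long segments is small
in their directions.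

Separation itself rests on the geometric Hahn-Banach theorem [mazur], obtained
from a maximal convex cone ([maximal_cone]). *)

Set Implicit Arguments.
Unset Strict Implicit.
Unset Printing Implicit Defensive.

Import Order.TTheory GRing.Theory Num.Theory.
Import numFieldNormedType.Exports.

Local Open Scope classical_set_scope.
Local Open Scope ring_scope.

(** * Continuous linear maps and convex combinations *)

Section ContLin.
Variable R : realType.
Implicit Types X Y : tvsType R.

Lemma contlin_ex X Y (f : X -> Y) : linear f -> continuous f ->
  exists L : contlin X Y, forall x, L x = f x.
Proof.
move=> lf cf.
by exists (SigSub (mem_set (conj lf cf) : (f : {ptws X -> Y}) \in
  [set g : {ptws X -> Y} | linear (g : X -> Y) /\ continuous (g : X -> Y)])).
Qed.

Lemma contlin_linear X Y (L : contlin X Y) : linear L.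
Proof. by have [] := set_valP L. Qed.

Lemma contlin_continuous X Y (L : contlin X Y) : continuous L.
Proof. by have [] := set_valP L. Qed.

HB.instance Definition _ X Y (L : contlin X Y) :=
  GRing.isLinear.Build R X Y *:%R L (contlin_linear L).

Lemma continuous_pair (T U V : topologicalType) (f : T -> U) (g : T -> V) :
  continuous f -> continuous g -> continuous (fun x => (f x, g x)).
Proof. by move=> cf cg x; apply: cvg_pair; [exact: cf|exact: cg]. Qed.

Lemma contlin_comp X Y Z (f : contlin X Y) (g : contlin Y Z) :
  exists h : contlin X Z, forall x, h x = g (f x).
Proof.
apply: contlin_ex; first by move=> a x y; rewrite linearP linearP.
by move=> x; apply: continuous_comp; exact: contlin_continuous.
Qed.

Lemma contlin_add X Y (f g : contlin X Y) :
  exists h : contlin X Y, forall x, h x = f x + g x.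
Proof.
apply: contlin_ex => [a x y|x].
  by rewrite !linearP scalerDr addrACA.
apply: (@continuous_comp X (Y * Y)%type Y (fun x => (f x, g x))
  (fun p => p.1 + p.2)); last exact: add_continuous.
by apply: continuous_pair; exact: contlin_continuous.
Qed.

Lemma contlin_rank1 X Y (f : contlin X R^o) (e : Y) :
  exists h : contlin X Y, forall x, h x = (f x : R) *: e.
Proof.
apply: contlin_ex => [a x y|x].
  by rewrite linearP scalerDl scalerA.
apply: (@continuous_comp X (R^o * Y)%type Y (fun x => (f x, e))
  (fun p => p.1 *: p.2)); last exact: scale_continuous.
apply: (@continuous_pair X R^o Y); first exact: contlin_continuous.
by move=> ?; exact: cvg_cst.
Qed.

Lemma contlin_inl X Y : exists h : contlin X (X * Y)%type, forall x, h x = (x, 0).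
Proof.
apply: contlin_ex => [a x y|x].
  by apply: injective_projections; rewrite /= ?scaler0 ?addr0.
by apply: cvg_pair; [exact: cvg_id|exact: cvg_cst].
Qed.

Lemma contlin_inr X Y : exists h : contlin Y (X * Y)%type, forall y, h y = (0, y).
Proof.
apply: contlin_ex => [a x y|x].
  by apply: injective_projections; rewrite /= ?scaler0 ?addr0.
by apply: cvg_pair; [exact: cvg_cst|exact: cvg_id].
Qed.

Lemma convex_setP (V : lmodType R) (A : set V) :
  convex_set A <-> forall x y t, 0 <= t -> t <= 1 -> A x -> A y ->
    A (t *: x + (1 - t) *: y).
Proof.
split => [cA x y t t0 t1 /mem_set Ax /mem_set Ay|cA x y t /set_mem Ax /set_mem Ay].
  have [k ->] : exists k : {i01 R}, t = k%:num.
    exists (@Itv01 R t t0 t1); by [].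
  exact: set_mem (cA x y k Ax Ay).
by apply/mem_set; apply: cA.
Qed.

End ContLin.

Section Affine.
Variables (R : realType) (V : tvsType R).

Lemma continuous_addscale (w : V) : continuous (fun p : R^o * V => p.2 + p.1 *: w).
Proof.
move=> p; apply: (@continuous_comp (R^o * V)%type (V * V)%type V
  (fun p => (p.2, p.1 *: w)) (fun p => p.1 + p.2)); last exact: add_continuous.
apply: cvg_pair; first exact: cvg_snd.
apply: (@continuous_comp (R^o * V)%type (R^o * V)%type V
  (fun p => (p.1, w)) (fun p => p.1 *: p.2)); last exact: scale_continuous.
by apply: (@cvg_pair _ _ _ _ (nbhs p.1)); [exact: cvg_fst|exact: cvg_cst].
Qed.

Lemma continuous_line (x v : V) : continuous (fun t : R => x + t *: v).
Proof.
move=> t; apply: (@continuous_comp R (R^o * V)%type V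
  (fun t => (t, x)) (fun p => p.2 + p.1 *: v)); last exact: continuous_addscale.
by apply: (@cvg_pair _ _ _ _ (nbhs (t : R^o))); [exact: cvg_id|exact: cvg_cst].
Qed.

Lemma continuous_affine (c : R) (v : V) : continuous (fun x : V => c *: x + v).
Proof.
move=> x; apply: (@continuous_comp V (V * V)%type V
  (fun x => (c *: x, v)) (fun p => p.1 + p.2)); last exact: add_continuous.
apply: cvg_pair; last exact: cvg_cst.
apply: (@continuous_comp V (R^o * V)%type V
  (fun x => (c, x)) (fun p => p.1 *: p.2)); last exact: scale_continuous.
by apply: (@cvg_pair _ _ _ _ (nbhs (c : R^o)));
  [exact: cvg_cst | exact: cvg_id].
Qed.

Lemma nbhs_affine (c : R) (v x : V) (U : set V) : nbhs (c *: x + v) U ->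
  nbhs x [set y | U (c *: y + v)].
Proof. exact: continuous_affine. Qed.

Lemma nbhs_line (x v : V) (U : set V) : nbhs x U ->
  exists2 d : R, 0 < d & forall t, `|t| <= d -> U (x + t *: v).
Proof.
move=> Ux; have /= := @continuous_line x v (0 : R) U.
rewrite scale0r addr0 => /(_ Ux) /nbhs_ballP[d /= d0 dU].
exists (d / 2); first by rewrite divr_gt0.
move=> t td; apply: dU; rewrite /ball /= sub0r normrN.
by apply: le_lt_trans td _; rewrite ltr_pdivrMr// ltr_pMr// ltr1n.
Qed.

(** Division by [t] brings [x + t o] close to [o] when [t] is large. *)
Lemma open_absorb (O : set V) (x o : V) : open O -> O o ->
  exists2 d : R, 0 < d & forall t, d < t -> exists2 u, O u & x + t *: o = t *: u.
Proof.
move=> oO Oo; have [d d0 dO] := nbhs_line x (open_nbhs_nbhs (conj oO Oo)).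
exists d^-1; first by rewrite invr_gt0.
move=> t dt; have t0 : 0 < t by apply: lt_trans dt; rewrite invr_gt0.
exists (o + t^-1 *: x).
  by apply: dO; rewrite ger0_norm ?invr_ge0 ?ltW// invf_plt.
by rewrite scalerDr scalerA divff ?gt_eqF// scale1r addrC.
Qed.

End Affine.

(** * The geometric Hahn-Banach theorem *)

Section Mazur.
Variables (R : realType) (V : tvsType R) (O : set V).
Hypotheses (openO : open O) (convO : convex_set O) (O0 : ~ O 0).

Let P : set V := [set x | exists t u, [/\ 0 < t, O u & x = t *: u]].

Let PD x y : P x -> P y -> P (x + y).
Proof.
move=> [s [u [s0 Ou ->]]] [t [w [t0 Ow ->]]].
have st0 : 0 < s + t by rewrite addr_gt0.
exists (s + t), ((s / (s + t)) *: u + (1 - s / (s + t)) *: w); split => //.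
  move/convex_setP : convO; apply => //.
  - by rewrite divr_ge0// ltW.
  - by rewrite ler_pdivrMr// mul1r lerDl ltW.
rewrite scalerDr !scalerA mulrBr mulr1 mulrCA divff ?gt_eqF// mulr1.
by rewrite [s + t - s]addrAC subrr add0r.
Qed.

Let PZ c x : 0 < c -> P x -> P (c *: x).
Proof.
move=> c0 [s [u [s0 Ou ->]]]; exists (c * s), u; split => //.
- by rewrite mulr_gt0.
- by rewrite scalerA.
Qed.

Let OP x : O x -> P x.
Proof. by move=> Ox; exists 1, x; rewrite scale1r. Qed.

Let P0 : ~ P 0.
Proof.
move=> [t [u [t0 Ou /esym/eqP]]]; rewrite scaler_eq0 gt_eqF//= => /eqP u0.
by apply: O0; rewrite -u0.
Qed.

Let P_line o x : O o -> exists2 d, 0 < d & forall t, d < t -> P (x + t *: o).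
Proof.
move=> Oo; have [d d0 dO] := open_absorb x openO Oo.
by exists d => // t dt; have [u Ou ->] := dO t dt; exists t, u; split => //; lra.
Qed.

Let good (A : set V) := [/\ forall x y, A x -> A y -> A (x + y),
  forall c x, 0 < c -> A x -> A (c *: x) & forall x, A x -> ~ P (- x)].

(** Among the convex cones that miss [- P], where [P] is the cone generated by
[O], a maximal one [A] satisfies [V = A `|` - A]: when adjoining [v] to [A]
creates a conflict, [a + v] lies in [- P] for some [a] in [A] or [a = 0], and
then [- v] is the sum of [a] and a point of [P], hence in [A]. *)
Lemma maximal_cone : O !=set0 -> exists A : set V, [/\ good A, P `<=` A &
  forall x, A x \/ A (- x)].
Proof.
move=> [p Op].
have [A [gA maxA]] : exists A, good A /\ forall B, A `<` B -> ~ good B.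
  apply: Zorn_bigcup => F Fgood Ftot; split.
  - move=> x y [A FA Ax] [B FB By]; have [AB|BA] := Ftot _ _ FA FB.
      by exists B => //; have [+ _ _] := Fgood _ FB; apply => //; exact: AB.
    by exists A => //; have [+ _ _] := Fgood _ FA; apply => //; exact: BA.
  - move=> c x c0 [A FA Ax]; exists A => //.
    by have [_ + _] := Fgood _ FA; exact.
  - by move=> x [A FA Ax]; have [_ _] := Fgood _ FA; exact.
have [AD AZ AP] := gA.
(* a good set may be empty, as the union of the empty chain is: adjoin 0 *)
pose A0 : set V := [set a | A a \/ a = 0].
have A0D x y : A0 x -> A0 y -> A0 (x + y).
  move=> [Ax|->] [Ay|->]; rewrite ?addr0 ?add0r; try by [left|right].
  by left; exact: AD.
have A0Z c x : 0 < c -> A0 x -> A0 (c *: x).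
  by move=> c0 [Ax|->]; [left; exact: AZ|right; rewrite scaler0].
have A0P x : A0 x -> ~ P (- x) by move=> [/AP//|->]; rewrite oppr0.
(* by maximality, v belongs to A as soon as adjoining it creates no conflict *)
have key v : (forall a, A0 a -> ~ P (- (a + v))) -> A v.
  move=> PAv; apply: contrapT => nAv.
  pose B := [set z | exists a t, [/\ A0 a, 0 <= t & z = a + t *: v]].
  have Bv : B v by exists 0, 1; rewrite add0r scale1r; split => //; right.
  apply: (maxA B).
    split; last by move=> /(_ v Bv).
    by move=> a Aa; exists a, 0; rewrite scale0r addr0; split => //; left.
  split.
  - move=> _ _ [a [s [Aa s0 ->]]] [b [t [Ab t0 ->]]].
    exists (a + b), (s + t); rewrite scalerDl addrACA.
    by split; [exact: A0D|exact: addr_ge0|].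
  - move=> c _ c0 [a [s [Aa s0 ->]]].
    exists (c *: a), (c * s); rewrite scalerDr scalerA.
    by split; [exact: A0Z|rewrite mulr_ge0// ltW|].
  - move=> _ [a [s [Aa s0 ->]]]; move: s0; rewrite le_eqVlt => /predU1P[<-|s0].
      by rewrite scale0r addr0; exact: A0P.
    move=> /(PZ (c := s^-1)); rewrite invr_gt0 => /(_ s0).
    rewrite scalerN scalerDr scalerA mulVf ?gt_eqF// scale1r.
    by apply: PAv; apply: A0Z => //; rewrite invr_gt0.
have A_0 : A 0 by apply: key => a; rewrite addr0; exact: A0P.
have A0A a : A0 a -> A a by move=> [//|->].
have PA : P `<=` A.
  move=> q Pq; apply: key => a Aa Paq; apply: (A0P _ Aa).
  by rewrite -(subrK q (- a)) -opprD; exact: PD.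
exists A; split => // x; have [Ax|nAx] := pselect (A x); first by left.
right; have [a [Aa Pax]] : exists a, A0 a /\ P (- (a + x)).
  apply: contrapT => /forallNP nax; apply: nAx; apply: key => a Aa Pax.
  by apply: (nax a).
by rewrite -(addNKr a (- x)) -opprD; apply: AD; [exact: A0A|exact: PA].
Qed.

(** With [p] in [O] and the cone [A] of [maximal_cone], the value at [x] of the
separating functional is the threshold [r] at which [x - t p] passes from [A]
to [- A] as [t] grows. Thresholds are unique, so linearity can be checked on the
defining property [Q], and [phi] is positive on [O] because [O] is open. It is
continuous since [p + x] and [p - x] stay in [O] for small [x]. *)
Theorem mazur : O !=set0 ->
  exists phi : contlin V R^o, forall u, O u -> 0 < phi u.
Proof.
move=> O_neq0; have [A [[AD AZ AP] PA Atot]] := maximal_cone O_neq0.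
have [p Op] := O_neq0.
pose Q x (r : R) := (forall t, t < r -> A (x - t *: p)) /\
                    (forall t, r < t -> A (t *: p - x)).
have Pp : P p by exact: OP.
have AP' x : A x -> P x -> A (- x) -> False.
  by move=> Ax Px ANx; apply: (AP _ ANx); rewrite opprK.
have Qlt x r s : (forall t, t < r -> A (x - t *: p)) ->
    (forall t, s < t -> A (t *: p - x)) -> r <= s.
  move=> xr xs; rewrite leNgt; apply/negP => rs.
  have [m [sm mr]] : exists m, s < m /\ m < r.
    by exists ((s + r) / 2); rewrite midf_lt//; have := midf_lt rs; lra.
  have [m' [mm' mr']] : exists m', m < m' /\ m' < r.
    by exists ((m + r) / 2); lra.
  have Pm : P ((m' - m) *: p) by apply: PZ => //; rewrite subr_gt0.
  apply: AP' (PA _ Pm) Pm _.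
  have -> : - ((m' - m) *: p) = (x - m' *: p) + (m *: p - x).
    by rewrite [RHS]addrC addrA subrK -scalerBl -scaleNr opprB.
  by apply: AD; [exact: xr|exact: xs].
have Qfun x r s : Q x r -> Q x s -> r = s.
  move=> [xr1 xr2] [xs1 xs2]; apply/eqP; rewrite eq_le.
  by apply/andP; split; [exact: Qlt xr1 xs2|exact: Qlt xs1 xr2].
have Qex x : exists r, Q x r.
  pose D : set R := [set t | A (x - t *: p)].
  have [d1 d10 xd1] := P_line x Op; have [d2 d20 xd2] := P_line (- x) Op.
  have D0 : D !=set0.
    by exists (- (d1 + 1)); rewrite /D /= scaleNr opprK; apply: PA; apply: xd1; lra.
  have Dub : ubound D (d2 + 1).
    move=> t Dt; rewrite leNgt; apply/negP => td.
    by apply: (AP _ Dt); rewrite opprB addrC; apply: xd2; lra.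
  have Ds : has_sup D by split => //; exists (d2 + 1).
  exists (sup D); split => t tr.
    have [s Dss ts'] : exists2 s, D s & t < s.
      have /(sup_adherent)/(_ Ds)[s' Ds'' ts''] : 0 < sup D - t by rewrite subr_gt0.
      by exists s' => //; move: ts''; rewrite subKr.
    have -> : x - t *: p = (x - s *: p) + (s - t) *: p.
      by rewrite scalerBl addrA subrK.
    by apply: AD => //; apply: PA; apply: PZ => //; rewrite subr_gt0.
  have [Ax|] := Atot (x - t *: p); last by rewrite opprB.
  by move: tr; rewrite ltNge => /negP[]; apply: sup_upper_bound.
have [phi Qphi] := choice Qex.
have phiE x r : Q x r -> phi x = r by exact: Qfun.
have phiD x y : phi (x + y) = phi x + phi y.
  apply: phiE; have [x1 x2] := Qphi x; have [y1 y2] := Qphi y; split=> t tr.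
    pose e := (phi x + phi y - t) / 2.
    have -> : x + y - t *: p = (x - (phi x - e) *: p) + (y - (phi y - e) *: p).
      rewrite addrACA -opprD -scalerDl; congr (_ - _ *: _); rewrite /e; lra.
    by apply: AD; [apply: x1|apply: y1]; rewrite /e; lra.
  pose e := (t - (phi x + phi y)) / 2.
  have -> : t *: p - (x + y) = ((phi x + e) *: p - x) + ((phi y + e) *: p - y).
    rewrite addrACA -opprD -scalerDl; congr (_ *: _ - _); rewrite /e; lra.
  by apply: AD; [apply: x2|apply: y2]; rewrite /e; lra.
have phi0 : phi 0 = 0 by have := phiD 0 0; rewrite addr0; lra.
have phiN x : phi (- x) = - phi x by have := phiD x (- x); rewrite subrr phi0; lra.
have phiZ_gt0 c x : 0 < c -> phi (c *: x) = c * phi x.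
  move=> c0; apply: phiE; have [x1 x2] := Qphi x; split=> t tr.
    have -> : c *: x - t *: p = c *: (x - (t / c) *: p).
      by rewrite scalerBr scalerA mulrCA divff ?gt_eqF// mulr1.
    by apply: AZ => //; apply: x1; rewrite ltr_pdivrMr// mulrC.
  have -> : t *: p - c *: x = c *: ((t / c) *: p - x).
    by rewrite scalerBr scalerA mulrCA divff ?gt_eqF// mulr1.
  by apply: AZ => //; apply: x2; rewrite ltr_pdivlMr// mulrC.
have phiZ c x : phi (c *: x) = c * phi x.
  have [c0|c0|<-] := ltgtP 0 c; last by rewrite scale0r mul0r.
    exact: phiZ_gt0.
  by rewrite -[c in LHS]opprK scaleNr phiN phiZ_gt0 ?oppr_gt0// mulNr opprK.
have phiP u : O u -> 0 < phi u.
  move=> Ou; have [d d0 dO] := nbhs_line p (open_nbhs_nbhs (conj openO Ou)).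
  apply: (lt_le_trans d0); have [u1 u2] := Qphi u.
  apply: (Qlt u) => // t td; apply: PA.
  have -> : u - t *: p = (u - d *: p) + (d - t) *: p.
    by rewrite scalerBl addrA subrK.
  apply: PD; last by apply: PZ => //; rewrite subr_gt0.
  by apply: OP; rewrite -scaleNr; apply: dO; rewrite normrN gtr0_norm.
have philin : linear (phi : V -> R^o).
  by move=> c x y; rewrite phiD phiZ.
have phip : phi p = 1.
  apply: phiE; split=> t t1.
    by rewrite -[X in X - _]scale1r -scalerBl; apply: PA; apply: PZ => //; rewrite subr_gt0.
  by rewrite -[X in _ - X]scale1r -scalerBl; apply: PA; apply: PZ => //; rewrite subr_gt0.
have phibd : exists2 U : set V, nbhs 0 U & forall x, U x -> `|phi x| <= 1.
  exists [set x | O (1 *: x + p) /\ O (-1 *: x + p)].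
    have nO c : nbhs 0 [set x | O (c *: x + p)].
      apply: nbhs_affine.
      by rewrite scaler0 add0r; exact: open_nbhs_nbhs.
    exact: (filterI (nO 1) (nO (-1))).
  move=> x [/phiP + /phiP]; rewrite !phiD !phiZ phip ler_norml; lra.
have phicont : continuous (phi : V -> R^o).
  have [U nU Ubd] := phibd.
  move=> x; apply/cvgrPdist_le => e e0 /=.
  have nxU : nbhs x [set y | U (e^-1 *: y + - (e^-1 *: x))].
    apply: nbhs_affine.
    by rewrite subrr.
  near=> y.
  have /Ubd : U (e^-1 *: y + - (e^-1 *: x)) by near: y.
  rewrite phiD phiN !phiZ -mulrBr normrM gtr0_norm ?invr_gt0//.
  by rewrite ler_pdivrMl// mulr1 distrC.
have [L LE] := contlin_ex philin phicont.
by exists L => u Ou; rewrite LE; exact: phiP.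
Unshelve. all: by end_near. Qed.

End Mazur.

(** * Strict separation and approximate affine minorants *)

Section Sep.
Variables (R : realType) (V : tvsType R).
Implicit Types A B E : set V.

Lemma open_diff A B : open B -> open [set a - b | a in A & b in B].
Proof.
move=> oB; rewrite openE => _ [a Aa [b Bb <-]].
have : nbhs (a - b) [set y | B (-1 *: y + a)].
  apply: nbhs_affine; rewrite scaleN1r opprB subrK.
  exact: open_nbhs_nbhs.
apply: filterS => x /= Bx; exists a => //; exists (-1 *: x + a) => //.
by rewrite scaleN1r opprD opprK addrC addrNK.
Qed.

Lemma convex_diff A B : convex_set A -> convex_set B ->
  convex_set [set a - b | a in A & b in B].
Proof.
move=> /convex_setP cA /convex_setP cB; apply/convex_setP.
move=> _ _ t t0 t1 [a Aa [b Bb <-]] [a' Aa' [b' Bb' <-]].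
exists (t *: a + (1 - t) *: a'); first exact: cA.
exists (t *: b + (1 - t) *: b'); first exact: cB.
by rewrite !scalerBr opprD addrACA.
Qed.

(** By local convexity [p] has an open convex neighbourhood [b] missing [E], and
[mazur] applies to the open set of differences of [E] and [b]. The inequality is
strict because [phi] takes on [b] a value greater than [phi p]. *)
Theorem strict_separation E (p : V) : closed E -> convex_set E -> ~ E p ->
  E !=set0 -> exists (phi : contlin V R^o) (c : R),
    phi p < c /\ forall x, E x -> c < phi x.
Proof.
move=> clE cE nEp [e Ee].
have [Bs Bconv [Bopen Bbasis]] := @locally_convex R V.
have /Bbasis[b [Bsb bp] bE] : nbhs p (~` E).
  by apply: open_nbhs_nbhs; split=> //; exact: closed_openC.
have ob := Bopen _ Bsb; have cb := Bconv _ (mem_set Bsb).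
have [||phi phiP] := mazur (open_diff E ob) (convex_diff cE cb).
- by move=> [x Ex [y /bE nEy /eqP]]; rewrite subr_eq0 => /eqP xy; rewrite xy in Ex.
- by exists (e - p); exists e => //; exists p.
have phi_lt x y : E x -> b y -> phi y < phi x.
  move=> Ex By; have := phiP (x - y); rewrite linearB subr_gt0; apply.
  by exists x => //; exists y.
have [d d0 db] := nbhs_line (e - p) (open_nbhs_nbhs (conj ob bp)).
have bq : b (p + d *: (e - p)) by apply: db; rewrite gtr0_norm.
exists phi, (phi (p + d *: (e - p))); split; last by move=> x Ex; exact: phi_lt.
rewrite linearD linearZ/= ltrDl mulr_gt0// linearB subr_gt0.
exact: phi_lt.
Qed.

Definition thicken (M : R) (w : V) (E : set V) : set V :=
  [set x | exists2 t, `|t| <= M & E (x + t *: w)].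

(** Compactness of the segment: if the whole segment through [x] avoids [E], so
do the parallel segments through the points near [x]. *)
Lemma closed_thicken M w E : closed E -> closed (thicken M w E).
Proof.
move=> clE; rewrite -[thicken _ _ _]setCK; apply: open_closedC.
rewrite openE => x nEx.
have /compact_near_coveringP/(_ V (nbhs x) (fun y t => ~ E (y + t *: w))) :=
  @segment_compact R (- M) M.
move=> /(_ (nbhs_filter x)) near_cover.
have /near_cover : forall t, `[- M, M]%classic t ->
    \forall s \near t & y \near x, ~ E (y + s *: w).
  move=> t /=; rewrite in_itv/= -ler_norml => tM.
  have nE : nbhs (x + t *: w) (~` E).
    apply: open_nbhs_nbhs; split; first exact: closed_openC.
    by move=> Ext; apply: nEx; exists t.
  have := @continuous_addscale R V w (t, x).
  move=> /(_ _ nE) [[A1 A2] [/= nA1 nA2] A12].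
  by exists (A1, A2) => // -[s y] /= [A1s A2y]; exact: (A12 (s, y)).
apply: filterS => y yK [t tM Ety]; apply: (yK t) => //.
by rewrite /= in_itv/= -ler_norml.
Qed.

Lemma convex_thicken M w E : convex_set E -> convex_set (thicken M w E).
Proof.
move=> /convex_setP cE; apply/convex_setP => x y t t0 t1 [r rM Er] [s sM Es].
exists (t * r + (1 - t) * s).
  apply: (le_trans (ler_normD _ _)); rewrite !normrM ger0_norm// [`|1 - t|]ger0_norm ?subr_ge0//.
  have -> : M = t * M + (1 - t) * M by ring.
  by rewrite lerD// ler_wpM2l// subr_ge0.
have -> : t *: x + (1 - t) *: y + (t * r + (1 - t) * s) *: w =
   t *: (x + r *: w) + (1 - t) *: (y + s *: w).
  by rewrite [(t * r + _) *: w]scalerDl !scalerDr !scalerA addrACA.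
exact: cE.
Qed.

Lemma sub_thicken M w E : 0 <= M -> E `<=` thicken M w E.
Proof. by move=> M0 x Ex; exists 0; rewrite ?normr0// scale0r addr0. Qed.

Definition thicken_seq M (s : seq V) E := foldr (thicken M) E s.

Lemma closed_thicken_seq M s E : closed E -> closed (thicken_seq M s E).
Proof. by move=> clE; elim: s => //= w s; exact: closed_thicken. Qed.

Lemma convex_thicken_seq M s E : convex_set E -> convex_set (thicken_seq M s E).
Proof. by move=> cE; elim: s => //= w s; exact: convex_thicken. Qed.

Lemma thicken_seq_mem M s E w x t : 0 <= M -> w \in s -> `|t| <= M -> E x ->
  thicken_seq M s E (x + t *: w).
Proof.
move=> M0 + tM Ex; have Es s' : thicken_seq M s' E x.
  by elim: s' => //= v s' IH; exact: sub_thicken.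
elim: s => //= v s IH; rewrite inE => /predU1P[->|/IH]; last exact: sub_thicken.
by exists (- t); rewrite ?normrN// scaleNr addrK.
Qed.

(** Used contrapositively: a point of [W] misses the thickened set as soon as [W]
misses [E] and is stable under the translations involved. *)
Lemma thicken_seq_sub M s E (W : set V) x :
  (forall u w t, w \in s -> W u -> W (u + t *: w)) ->
  W x -> thicken_seq M s E x -> exists2 u, W u & E u.
Proof.
elim: s x => [|w s IH] x Ws Wx /=; first by exists x.
move=> [t _]; apply: IH; last by apply: Ws => //; exact: mem_head.
by move=> u v r vs; apply: Ws; rewrite inE vs orbT.
Qed.

End Sep.

Section Approx.
Variables (R : realType) (V : tvsType R).

(** If a closed convex set lies above height [0] over a subspace [W], then [0]
on [W] extends only approximately to an affine minorant of it, whence the two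
errors: [d] on the height and [e] on the size of [phi] in the given directions
of [W]. Separating [(0, - d)] from [E] thickened by segments of half-length [M]
yields [M * `|phi w| <= r0 + phi v0 + d]; the point [v0], itself
among the directions, rules out a vertical hyperplane and bounds the
right-hand side. *)
Theorem approx_minorant (E : set (V * R^o)) (W : set V) (s : seq V) v0 r0 d e :
  closed E -> convex_set E ->
  (forall u v t, W u -> W v -> W (u + t *: v)) -> {in s, forall w, W w} ->
  (forall u r, W u -> E (u, r) -> 0 <= r) ->
  v0 \in s -> E (v0, r0) -> 0 < d -> 0 < e ->
  exists phi : contlin V R^o, {in s, forall w, `|phi w| <= e} /\
    forall v r, E (v, r) -> 0 <= r + phi v + d.
Proof.
move=> clE cE Wlin sW Epos v0s E0 d0 e0.
have r0_ge0 : 0 <= r0 by apply: Epos E0; exact: sW.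
(* the bound below reads M * |phi w| <= 2 * (r0 + d) <= M * e once 2 <= M *)
pose M := 2 + 2 * (r0 + d) / e.
have M2 : 2 <= M.
  by rewrite lerDl; apply: divr_ge0; [lra|exact: ltW].
have M0 : 0 <= M by lra.
pose s' : seq (V * R^o) := [seq (w, 0) | w <- s].
have W0 : W 0 by rewrite -(subrr v0) -scaleN1r; apply: Wlin; exact: sW.
have nE : ~ thicken_seq M s' E (0, - d).
  move=> /(thicken_seq_sub (W := [set p | W p.1 /\ p.2 = - d]))[].
  - move=> u _ t /mapP[w ws ->] [Wu ud] /=; split; first by apply: Wlin => //; exact: sW.
    by rewrite scaler0 addr0.
  - by split.
  - by move=> [u r] [/= Wu ->] /(Epos _ _ Wu); lra.
have [psi [c [psi0 psiE]]] : exists (psi : contlin (V * R^o)%type R^o) (c : R),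
    psi (0, - d) < c /\ forall x, thicken_seq M s' E x -> c < psi x.
  apply: strict_separation => //.
  - exact: closed_thicken_seq.
  - exact: convex_thicken_seq.
  - exists ((v0, r0) + 0 *: (v0, 0)); apply: thicken_seq_mem => //.
      exact: map_f.
    by rewrite normr0.
pose b : R := psi (0, 1).
have psiS v r : psi (v, r) = psi (v, 0) + r * b :> R.
  rewrite -[r * b]/(r *: (b : R^o)) -linearZ -linearD; congr (psi _).
  by apply: injective_projections; rewrite /= ?scaler0 ?addr0// add0r /GRing.scale /= mulr1.
have psi00 : psi (0, 0) = 0 :> R by exact: linear0.
have psiEt v r w t : E (v, r) -> w \in s -> `|t| <= M ->
    - d * b < psi (v, 0) + r * b + t * psi (w, 0).
  move=> Evr ws tM; have : thicken_seq M s' E ((v, r) + t *: (w, 0)).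
    by apply: thicken_seq_mem => //; exact: map_f.
  move=> /psiE cpsi; have := lt_trans psi0 cpsi.
  by rewrite linearD linearZ /= [in X in X < _]psiS [in X in _ < X]psiS psi00 add0r.
(* the direction v0, with t = -1, cancels psi (v0, 0): only the height is left *)
have b0 : 0 < b.
  have := psiEt _ _ _ (-1) E0 v0s; rewrite normrN normr1 => /(_ ltac:(lra)).
  rewrite mulN1r addrAC subrr add0r -subr_gt0 => rdb.
  have : 0 < (r0 + d) * b by move: rdb; congr (_ < _); ring.
  by rewrite pmulr_rgt0//; lra.
have [phi phiE] : exists phi : contlin V R^o, forall v, phi v = b^-1 * psi (v, 0).
  have [i iE] := contlin_inl V R^o; have [h hE] := contlin_comp i psi.
  have [phi phiE] := contlin_rank1 h (b^-1 : R^o).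
  by exists phi => v; rewrite phiE hE iE [LHS]mulrC.
have phiEt v r w t : E (v, r) -> w \in s -> `|t| <= M ->
    0 < r + phi v + d + t * phi w.
  move=> Evr ws tM; have := psiEt _ _ _ _ Evr ws tM.
  rewrite -(ltr_pM2l (x := b^-1)) ?invr_gt0// !phiE -subr_gt0; congr (_ < _).
  by field; rewrite gt_eqF.
exists phi; split; last first.
  by move=> v r Evr; have := phiEt _ _ _ 0 Evr v0s; rewrite normr0 mul0r addr0 => /(_ M0)/ltW.
have phiM w : w \in s -> M * `|phi w| <= r0 + phi v0 + d.
  move=> ws; have := phiEt _ _ _ M E0 ws; have := phiEt _ _ _ (- M) E0 ws.
  rewrite normrN ger0_norm// lexx => /(_ isT) + /(_ isT).
  by case: (ger0P (phi w)) => _; lra.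
have v0M : `|phi v0| <= r0 + d.
  have := phiM _ v0s; have := ler_norm (phi v0).
  have : 2 * `|phi v0| <= M * `|phi v0| by rewrite ler_wpM2r.
  lra.
move=> w /phiM wM; rewrite -(ler_pM2l (x := M)); last by lra.
apply: le_trans wM _.
have -> : M * e = 2 * e + 2 * (r0 + d) by rewrite /M; field; rewrite gt_eqF.
by have := ler_norm (phi v0); lra.
Qed.

End Approx.

(** * Ordering cones and the epigraph of the conjugate *)

Section Cone.
Variables (R : realType) (Y : tvsType R) (K : set Y).
Hypotheses (convK : convex_set K) (coneK : is_cone K).

Lemma coneD x y : K x -> K y -> K (x + y).
Proof.
move=> Kx Ky; have -> : x + y = 2 *: (2^-1 *: x + (1 - 2^-1) *: y).
  have -> : 1 - 2^-1 = 2^-1 :> R by lra.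
  by rewrite -scalerDr scalerA divff ?scale1r.
by apply: coneK => //; move/convex_setP : convK; apply => //; lra.
Qed.

Lemma interior_coneD x y : K x -> K° y -> K° (x + y).
Proof.
move=> Kx; rewrite /interior => nKy.
have : nbhs (x + y) [set z | K (1 *: z + (- x))].
  by apply: nbhs_affine; rewrite scale1r addrAC subrr add0r.
by apply: filterS => z /= Kz; rewrite -(subrK x z) -[z in z - _]scale1r; exact: coneD.
Qed.

Lemma interior_coneZ c x : 0 < c -> K° x -> K° (c *: x).
Proof.
move=> c0; rewrite /interior => nKx.
have : nbhs (c *: x) [set z | K (c^-1 *: z + 0)].
  by apply: nbhs_affine; rewrite addr0 scalerA mulVf ?gt_eqF// scale1r.
apply: filterS => z /=; rewrite addr0 => /(coneK c0).
by rewrite scalerA divff ?gt_eqF// scale1r.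
Qed.

Lemma interior_nbhs x : K° x -> nbhs x K°.
Proof. by move=> Kx; apply: open_nbhs_nbhs; split => //; exact: open_interior. Qed.

Lemma interior_cone_absorb x e : K° e ->
  exists2 d, 0 < d & forall t, d < t -> K° (x + t *: e).
Proof.
move=> Ke; have [d d0 dK] := open_absorb x (@open_interior _ K) Ke.
exists d => // t dt; have [u Ku ->] := dK t dt.
by apply: interior_coneZ => //; lra.
Qed.

Lemma lt_coneE (a b : Y) : lt_cone K a%:E b%:E <-> K° (b - a).
Proof.
split; first by move=> [k Kk /eqP]; rewrite eqr_oppLR opprB => /eqP <-.
by move=> Kba; exists (b - a) => //; rewrite opprB.
Qed.

Variable X : tvsType R.

Lemma edom_finite (F : X -> \bar Y) x : ~ range F -oo%E -> edom F x ->
  exists a, F x = a%:E.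
Proof.
move=> FNoo; rewrite /edom /=.
by case Fx : (F x) => [a| |] //; [exists a|case: FNoo; exists x].
Qed.

(** If [y] is not below any finite [L x - F x], slide it down along an interior
direction [e] of [K] as far as this remains true. The condition is closed, so it
still holds at the final point [y - t0 e]; as it fails right after, this point
is a weak supremum. The slide is bounded because [F] takes a finite value. *)
Lemma epi_conjP (F : X -> \bar Y) (L : contlin X Y) (y : Y) :
  K 0 -> K° !=set0 -> proper_map F ->
  epi_conj K F (L, y) <-> forall x a, F x = a%:E -> ~ K° (L x - a - y).
Proof.
move=> K0 [e Ke] [[x0 Fx0] FNoo]; split.
  move=> [v [vF vsup] [k Kk]] /=; case: v vF vsup => // v vF vsup [vky] x a Fx Kxa.
  have : ~ lt_cone K v%:E ((L x)%:E - F x)%E by apply: vF; exists x.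
  rewrite Fx /= => /lt_coneE; apply.
  have -> : L x - a - v = k + (L x - a - y) by rewrite -vky opprD addrCA [k + _]addrC subrK.
  exact: interior_coneD.
move=> yF.
have [a0 Fa0] : exists a, F x0 = a%:E.
  exact: edom_finite.
have shift t (b c : Y) : b - (c - t *: e) = b - c + t *: e.
  by rewrite opprB addrA addrAC.
pose D : set R := [set t | 0 <= t /\
   forall x a, F x = a%:E -> ~ K° (L x - a - (y - t *: e))].
have D0 : D 0 by split => // x a; rewrite scale0r subr0; exact: yF.
have [d d0 dK] := interior_cone_absorb (L x0 - a0 - y) Ke.
have supD : has_sup D.
  split; [by exists 0|exists d => t [t0 Dt]].
  rewrite leNgt; apply/negP => /dK Kt; apply: (Dt _ _ Fa0).
  by rewrite shift.
pose t0 := sup D.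
have t0_ge0 : 0 <= t0 by exact: sup_upper_bound.
exists (y - t0 *: e)%:E; last first.
  exists (t0 *: e); last exact: (congr1 EFin (subrK (t0 *: e) y)).
  move: t0_ge0; rewrite le_eqVlt => /predU1P[<-|t0_gt0]; first by rewrite scale0r.
  by apply: coneK => //; exact: interior_subset.
split.
  (* were y - t0 e below some L x - a, so would be y - t e with t in D near t0 *)
  move=> _ [x _ <-]; case Fx : (F x) => [a| |] //=; last first.
    by move=> _; apply: FNoo; exists x.
  move=> /lt_coneE Kv.
  have [r r0 rK] := nbhs_line e (interior_nbhs Kv).
  have [t [tge0 Dt] tr] : exists2 t, D t & t0 - r < t.
    have [t Dt tr] := sup_adherent r0 supD; by exists t.
  apply: (Dt _ _ Fx).
  have -> : L x - a - (y - t *: e) = (t - t0 + r) *: e +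
      (L x - a - (y - t0 *: e) + (- r) *: e).
    by rewrite !shift -(addrA (L x - a - y)) -scalerDl addrCA -scalerDl; congr (_ + _ *: _); ring.
  apply: interior_coneD; last by apply: rK; rewrite normrN gtr0_norm.
  by apply: coneK; [lra|exact: interior_subset].
(* a point below y - t0 e is also below y - (t0 + r) e for a small r > 0 *)
move=> u; case: u => [u| |] //=; last by move=> _; exists ((L x0)%:E - F x0)%E; [exists x0|rewrite Fa0].
move=> /lt_coneE Kv.
have [r r0 rK] := nbhs_line e (interior_nbhs Kv).
have : ~ D (t0 + r).
  by move=> /(sup_upper_bound supD); rewrite -/t0; lra.
move=> /not_andP[|/existsNP[x /existsNP[a /not_implyP[Fx /contrapT Kx]]]].
  by move=> /negP; rewrite -ltNge; lra.
exists ((L x)%:E - F x)%E; first by exists x.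
rewrite Fx /=; apply/lt_coneE.
have -> : L x - a - u = (y - t0 *: e - u + (- r) *: e) + (L x - a - (y - (t0 + r) *: e)).
  rewrite shift [y - t0 *: e - u]addrAC -(scaleNr t0) -[in RHS](addrA (y - u)).
  rewrite -scalerDl addrACA -scalerDl.
  have -> : - t0 - r + (t0 + r) = 0 by ring.
  by rewrite scale0r addr0 addrC addrA subrK.
by apply: interior_coneD => //; apply: interior_subset; apply: rK; rewrite normrN gtr0_norm.
Qed.

End Cone.

Lemma affine_ge0 (R : realType) (a b : R) :
  (forall t, 0 < t -> 0 <= a + t * b) -> 0 <= a /\ 0 <= b.
Proof.
move=> ab; split; rewrite leNgt; apply/negP => lt0.
  have [b0|b0] := ltP 0 b.
    have := ab (- a / (2 * b)); rewrite divr_gt0 ?mulr_gt0 ?oppr_gt0// => /(_ isT).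
    have -> : - a / (2 * b) * b = - a / 2 by field; rewrite gt_eqF.
    lra.
  by have := ab 1 ltr01; lra.
have := ab (`|a| / - b + 1); rewrite mulrDl mul1r.
have -> : `|a| / - b * b = - `|a| by field; rewrite lt_eqF.
have : 0 <= `|a| / - b by apply: divr_ge0 => //; lra.
by have := ler_norm a; lra.
Qed.

Section ConeSep.
Variables (R : realType) (Y : tvsType R) (K : set Y).
Hypotheses (convK : convex_set K) (coneK : is_cone K) (K_0 : K 0).
Hypothesis K_int : K° !=set0.

Lemma convex_interior_cone : convex_set K°.
Proof.
apply/convex_setP => x y t t0 t1 Kx Ky.
have KZ c z : 0 <= c -> K z -> K (c *: z).
  by rewrite le_eqVlt => /predU1P[<-|c0]; [rewrite scale0r|exact: coneK].
have [->|tn0] := eqVneq t 0; first by rewrite scale0r add0r subr0 scale1r.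
rewrite addrC; apply: interior_coneD => //.
  by apply: KZ; [rewrite subr_ge0|exact: interior_subset].
by apply: interior_coneZ => //; rewrite lt0r tn0.
Qed.

(** [mazur] applied to the open convex set [Q + int K]. Positive homogeneity of
[K] separates the resulting inequality [0 < phi q + t (phi k)], [t > 0], into
the conditions on [Q] and on [K]. *)
Theorem cone_separation (Q : set Y) : convex_set Q -> Q !=set0 ->
  (forall q, Q q -> ~ K° (- q)) ->
  exists phi : contlin Y R^o, [/\ forall k, K k -> 0 <= phi k,
    forall k, K° k -> 0 < phi k & forall q, Q q -> 0 <= phi q].
Proof.
move=> cQ [q0 Qq0] QK; have [i0 Ki0] := K_int.
pose B : set Y := [set b | K° (- b)].
have oB : open B.
  rewrite openE => b Bb; have : nbhs b [set y | K° (-1 *: y + 0)].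
    by apply: nbhs_affine; rewrite addr0 scaleN1r; exact: interior_nbhs.
  by apply: filterS => y /=; rewrite addr0 scaleN1r.
have cB : convex_set B.
  apply/convex_setP => x y t t0 t1 Bx By; rewrite /B /= opprD -!scalerN.
  by move/convex_setP: convex_interior_cone; apply.
have [||phi phiP] := mazur (open_diff Q oB) (convex_diff cQ cB).
- move=> [q Qq [b Bb /eqP]]; rewrite subr_eq0 => /eqP qb.
  by apply: (QK q Qq); rewrite qb.
- by exists (q0 - - i0); exists q0 => //; exists (- i0) => //; rewrite /B /= opprK.
have phi_gt q k : Q q -> K° k -> 0 < phi q + phi k.
  move=> Qq Kk; rewrite -linearD; apply: phiP; exists q => //.
  by exists (- k); rewrite /B /= opprK.
have phi_int q k : Q q -> K° k -> 0 <= phi q /\ 0 <= phi k.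
  move=> Qq Kk; apply: affine_ge0 => t t0; apply: ltW.
  rewrite -[t * phi k]/(t *: (phi k : R^o)) -linearZ; apply: phi_gt => //.
  exact: interior_coneZ.
have phi_gt0 k : K° k -> 0 < phi k.
  move=> Kk; have [d d0 dK] := nbhs_line (q0 + k) (interior_nbhs Kk).
  have /(phi_int _ _ Qq0)[_] : K° (k + (- d) *: (q0 + k)).
    by apply: dK; rewrite normrN gtr0_norm.
  rewrite linearD linearZ linearD /=.
  have : 0 < d * (phi q0 + phi k) by rewrite mulr_gt0// phi_gt.
  rewrite /GRing.scale /=; lra.
exists phi; split => //; last by move=> q Qq; have [] := phi_int q i0 Qq Ki0.
move=> k Kk; have [] // := @affine_ge0 R (phi k) (phi i0) _ => t t0.
apply: ltW; rewrite -[t * phi i0]/(t *: (phi i0 : R^o)) -linearZ -linearD.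
by apply/phi_gt0/interior_coneD => //; exact: interior_coneZ.
Qed.

End ConeSep.

(** * The topology of pointwise convergence *)

Section Top.
Variables (R : realType) (X Y : tvsType R).

Lemma continuous_eval (x : X) : continuous (fun L : contlin X Y => L x).
Proof.
move=> L.
have H : (set_val : contlin X Y -> {ptws X -> Y}) @ L --> (set_val L : {ptws X -> Y}).
  exact: initial_continuous.
have FF : Filter ((set_val : contlin X Y -> {ptws X -> Y}) @ L).
  exact: (fmap_filter _ (nbhs_filter L)).
have [+ _] := @pointwise_cvgP X Y _ (set_val L) FF.
by move=> /(_ H) /(_ x).
Qed.

(** Perturbations of [L] of the form [a y0], with [a] scalar and small at finitely
many points, converge to [L]: they are the basis [D] of a filter [G] that
converges pointwise to [L]. *)
Lemma nbhs_contlin (L : contlin X Y) (y0 : Y) (B : set (contlin X Y)) : nbhs L B ->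
  exists (s : seq X) (e : R), 0 < e /\ forall L' : contlin X Y,
    (exists2 a : X -> R, forall x, L' x = L x + a x *: y0 & {in s, forall x, `|a x| <= e}) ->
    B L'.
Proof.
pose D (p : seq X * R) := [set L' : contlin X Y |
  exists2 a : X -> R, forall x, L' x = L x + a x *: y0 &
    {in p.1, forall x, `|a x| <= p.2}].
pose G := filter_from [set p : seq X * R | 0 < p.2] D.
have FG : Filter G.
  apply: filter_from_filter; first by exists ([::], 1) => /=.
  move=> [s1 e1] [s2 e2] /= e10 e20; exists (s1 ++ s2, Num.min e1 e2) => /=.
    by rewrite lt_min e10.
  move=> L' [a L'E aE]; split; exists a => // x xs; apply: le_trans (aE x _) _ => /=.
  - by rewrite mem_cat xs.
  - by rewrite ge_min lexx.
  - by rewrite mem_cat xs orbT.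
  - by rewrite ge_min lexx orbT.
have GL : (set_val : contlin X Y -> {ptws X -> Y}) @ G --> (set_val L : {ptws X -> Y}).
  apply/pointwise_cvgP => x U Ux.
  have [d d0 dU] := nbhs_line y0 (Ux : nbhs (L x) U).
  exists ([:: x], d) => //= L' [a L'E aE].
  rewrite /preimage /= -[set_val L' x]/(L' x) L'E; apply: dU.
  by apply: aE; rewrite mem_head.
move=> [_ [[W oW <-] WL WB]].
have /GL : nbhs (set_val L : {ptws X -> Y}) W by exact: open_nbhs_nbhs.
move=> [[s e] /= e0 DW]; exists s, e; split => // L' L'P.
by apply: WB; apply: (DW L').
Qed.

Variable K : set Y.
Hypotheses (convK : convex_set K) (coneK : is_cone K) (K_0 : K 0).
Hypothesis K_int : K° !=set0.

Lemma closed_epi_conj (F : X -> \bar Y) : proper_map F ->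
  closed (epi_conj K F).
Proof.
move=> pF.
have -> : epi_conj K F = \bigcap_(xa in [set xa | F xa.1 = xa.2%:E])
    ~` [set p : contlin X Y * Y | K° (p.1 xa.1 - xa.2 - p.2)].
  apply/seteqP; split => [[L y]|[L y]].
    by move=> /epi_conjP H [x a] /= Fx; apply: H.
  by move=> H; apply/epi_conjP => // x a Fx; exact: (H (x, a)).
apply: closed_bigI => -[x a] _; apply: open_closedC.
have cont : continuous (fun p : contlin X Y * Y => p.1 x - a - p.2).
  move=> p; apply: (@continuous_comp _ (Y * Y)%type Y
    (fun p : contlin X Y * Y => (p.1 x - a, p.2)) (fun q => q.1 - q.2));
    last exact: sub_continuous.
  apply: continuous_pair => [{}p|q]; last exact: cvg_snd.
  apply: (@continuous_comp _ (Y * Y)%type Y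
    (fun p : contlin X Y * Y => (p.1 x, a)) (fun q => q.1 - q.2));
    last exact: sub_continuous.
  apply: continuous_pair => q; last exact: cvg_cst.
  apply: (@continuous_comp _ (contlin X Y) Y fst (fun L : contlin X Y => L x)).
    exact: cvg_fst.
  exact: continuous_eval.
by move/continuousP : cont; apply; exact: open_interior.
Qed.

End Top.

(** * Extended-valued mappings *)

Section Epi.
Variables (R : realType) (X Y : tvsType R).

Lemma epiE (K : set Y) (F : X -> \bar Y) x y :
  epi K F (x, y) <-> exists2 a, F x = a%:E & K (y - a).
Proof.
split.
  rewrite /epi /=; case: (F x) => [a| |] [k Kk] // [<-]; exists a => //.
  by rewrite addrAC subrr add0r.
move=> [a Fa Ka]; exists (y - a) => //.
by rewrite /= Fa; congr EFin; rewrite addrC subrK.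
Qed.

Lemma lsc_epi_closed (F : X -> \bar Y) (f : contlin Y R^o) : ~ range F -oo%E ->
  lower_semicontinuous (er_map f \o F : X -> \bar R) ->
  closed [set p : X * R^o | exists2 a, F p.1 = a%:E & f a <= p.2].
Proof.
move=> FNoo lscF; rewrite -[[set p | _]]setCK; apply: open_closedC.
rewrite openE => -[x r] /= nH.
have [r' rr' r'F] : exists2 r', r < r' & (r'%:E < (er_map f \o F) x)%E.
  rewrite /=; case Fx : (F x) => [a| |] /=.
  - have ra : r < f a by rewrite ltNge; apply/negP => ar; apply: nH; exists a.
    by exists ((r + f a) / 2); rewrite ?lte_fin ?midf_lt.
  - by exists (r + 1); rewrite ?ltry// ltrDl.
  - by case: FNoo; exists x.
have [V nV VF] := lscF _ _ r'F.
exists (V, [set s : R^o | s < r']); first by split => //; exact: lt_nbhsl.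
move=> [x' s] /= [Vx' sr'] [a Fa fas].
have := VF _ Vx'; rewrite /= Fa lte_fin ltNge => /negP; apply.
exact: (le_trans fas (ltW sr')).
Qed.

End Epi.

Section Sums.
Variables (R : realType) (X Y Z : tvsType R).

Lemma add_indicP (F : X -> \bar Y) (D : set X) x b :
  (F \+ indic_map Y D)%E x = b%:E <-> D x /\ F x = b%:E.
Proof.
rewrite /indic_map; case: ifPn => [/set_mem Dx|/negP nDx]; last first.
  split; first by case: (F x).
  by move=> [Dx]; case: nDx; exact: mem_set.
case: (F x) => [a| |]; split => // -[].
- by rewrite addr0 => ->.
- by move=> _ ->; rewrite /adde /= addr0.
- by [].
- by [].
Qed.

Lemma lagrangianP (F : X -> \bar Y) (D : set X) (T : contlin Z Y)
    (G : X -> \bar Z) x b :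
  (F \+ indic_map Y D \+ (er_map T \o G))%E x = b%:E <->
  D x /\ exists a z, [/\ F x = a%:E, G x = z%:E & b = a + T z].
Proof.
have FD := add_indicP F D x.
split.
  case FDx : ((F \+ indic_map Y D)%E x) => [a| |]; rewrite /= in FDx *; rewrite ?FDx /=;
    case Gx : (G x) => [z| |] //= -[<-].
  have [/(_ FDx)[Dx Fx] _] := FD a.
  by split => //; exists a, z.
move=> [Dx [a [z [Fx Gx ->]]]].
by have [_ /(_ (conj Dx Fx)) /= ->] := FD a; rewrite Gx.
Qed.

Lemma add_indic_Noo (F : X -> \bar Y) (D : set X) : ~ range F -oo%E ->
  ~ range (F \+ indic_map Y D)%E -oo%E.
Proof.
move=> FNoo [x _]; rewrite /indic_map.
by case Fx : (F x) => [a| |] /=; [case: ifP|case: ifP|case: FNoo; exists x].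
Qed.

Lemma lagrangian_Noo (F : X -> \bar Y) (D : set X) (T : contlin Z Y)
    (G : X -> \bar Z) : ~ range F -oo%E -> ~ range G -oo%E ->
  ~ range (F \+ indic_map Y D \+ (er_map T \o G))%E -oo%E.
Proof.
move=> /(add_indic_Noo (D := D)) FNoo GNoo [x _] /=.
case FDx : ((F \+ indic_map Y D)%E x) => [a| |]; rewrite /= in FDx *; rewrite ?FDx /=.
all: case Gx : (G x) => [z| |] //=; try by case: GNoo; exists x.
all: by case: FNoo; exists x.
Qed.

(** Feasibility is a condition on the epigraph of [G], which is what the convexity
and closedness assumptions on [G] bear on. *)
Lemma constraintP (S : set Z) (C : set X) (G : X -> \bar Z) x :
  (C `&` G @^-1` (EFin @` (-%R @` S))) x <-> C x /\ epi S G (x, 0).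
Proof.
split.
  move=> [Cx [_ [s Ss <-] Gx]]; split => //; apply/epiE.
  by exists (- s) => //; rewrite sub0r opprK.
move=> [Cx /epiE[z Gx Sz]]; split => //; exists z => //.
by exists (- z); [rewrite -sub0r|rewrite opprK].
Qed.

End Sums.

(** * Approximate Lagrange multipliers *)

Section Multipliers.
Variables (R : realType) (X Y Z : tvsType R) (K : set Y) (S : set Z).
Hypotheses (convK : convex_set K) (coneK : is_cone K) (K_0 : K 0).
Hypothesis K_int : K° !=set0.
Variables (C : set X) (F : X -> \bar Y) (G : X -> \bar Z).
Hypotheses (FNoo : ~ range F -oo%E) (GNoo : ~ range G -oo%E).

Local Notation feasible := (C `&` G @^-1` (EFin @` (-%R @` S))).
Local Notation primal := (F \+ indic_map Y feasible)%E.
Local Notation lagrangian T :=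
  (F \+ indic_map Y C \+ (er_map (T : contlin Z Y) \o G))%E.

Variables (x0 : X) (a0 : Y).
Hypotheses (x0_feasible : feasible x0) (Fx0 : F x0 = a0%:E).

Let primal_proper : proper_map primal.
Proof.
split; last exact: add_indic_Noo.
exists x0; rewrite /edom /=.
by have /= -> := (add_indicP F feasible x0 a0).2 (conj x0_feasible Fx0).
Qed.

Let lagrangian_proper T : proper_map (lagrangian T).
Proof.
split; last exact: lagrangian_Noo.
have [Cx0 /epiE[z0 Gz0 _]] := (constraintP S C G x0).1 x0_feasible.
exists x0; rewrite /edom /=.
have /= -> // := (lagrangianP F C T G x0 (a0 + T z0)).2 _.
by split=> //; exists a0, z0.
Qed.

Let epi_conjE (H : X -> \bar Y) L y : proper_map H -> epi_conj K H (L, y) <->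
  forall x a, H x = a%:E -> ~ K° (L x - a - y).
Proof. by move=> ?; exact: epi_conjP. Qed.

(** Weak duality, together with the closedness of a conjugate epigraph. *)
Lemma closure_lagrangian_subset :
  closure (\bigcup_(T in Lplus S K) epi_conj K (lagrangian T)) `<=`
  epi_conj K primal.
Proof.
rewrite [X in _ `<=` X](closure_id _).1; last exact: closed_epi_conj.
apply: closure_subset => -[L y] [T TSK] /(epi_conjE _ _ (lagrangian_proper T)) H.
apply/(epi_conjE _ _ primal_proper) => x a /add_indicP[Ax Fx] Kx.
have [Cx /epiE[z Gx Sz]] := (constraintP S C G x).1 Ax.
apply: (H x (a + T z)) => //.
  by apply/lagrangianP; split => //; exists a, z.
have -> : (L : contlin X Y) x - (a + T z) - y =
    T (0 - z) + ((L : contlin X Y) x - a - y).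
  by rewrite sub0r linearN [RHS]addrC opprD addrA; exact: addrAC.
by apply: interior_coneD => //; apply: TSK; exists (0 - z).
Qed.

Hypotheses (C_closed : closed C) (convC : convex_set C).
Hypotheses (F_convex : K_convex K F) (G_convex : K_convex S G).
Hypothesis G_closed : K_epi_closed S G.
Variables (L : contlin X Y) (y : Y).

(** The convex set handed to [cone_separation] consists of all the points above
some [F x - L x + y] with [x] feasible. It is described through the epigraph of
[F], whose convexity it inherits. *)
Lemma scalarization :
  (forall x a, feasible x -> F x = a%:E -> ~ K° (L x - a - y)) ->
  exists f : contlin Y R^o,
    [/\ forall k, K k -> 0 <= f k, forall k, K° k -> 0 < f k &
        forall x a, feasible x -> F x = a%:E -> 0 <= f (a - L x + y)].
Proof.
move=> LyF; pose Q : set Y :=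
  [set v | exists2 x, feasible x & epi K F (x, v + L x - y)].
have [] := @cone_separation R Y K _ _ _ _ Q _ _ _ => //.
- apply/convex_setP => v v' t t0 t1.
  move=> [x /constraintP[Cx Gx] Fx] [x' /constraintP[Cx' Gx'] Fx'].
  exists (t *: x + (1 - t) *: x').
    apply/constraintP; split; first by move/convex_setP : convC; apply.
    move/convex_setP : G_convex => /(_ _ _ t t0 t1 Gx Gx'); congr (epi S G _).
    by apply: injective_projections; rewrite /= ?scaler0 ?addr0.
  move/convex_setP : F_convex => /(_ _ _ t t0 t1 Fx Fx'); congr (epi K F _).
  apply: injective_projections => //=.
  rewrite [L (_ + _)]linearD !linearZ /= !scalerBr !scalerDr addrACA.
  rewrite [in LHS](addrACA (t *: v)).
  by rewrite -opprD -scalerDl [t + _]addrC subrK scale1r.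
- exists (a0 - L x0 + y), x0 => //; apply/epiE; exists a0 => //.
  by rewrite [_ + L x0]addrAC subrK addrK subrr.
- move=> v [x Ax /epiE[a Fx Kv]] KNv; apply: (LyF _ _ Ax Fx).
  have -> : L x - a - y = (v + L x - y - a) - v.
    by rewrite [v + L x]addrC !(addrAC _ v) subrK addrAC.
  exact: interior_coneD.
move=> f [f1 f2 fQ]; exists f; split => // x a Ax Fx.
apply: fQ; exists x => //; apply/epiE; exists a => //.
by rewrite [_ + L x]addrAC subrK addrK subrr.
Qed.

Hypotheses (S_closed : closed S) (coneS : is_cone S).
Hypothesis S_neq0 : S !=set0.

Let S_0 : S 0.
Proof.
have [s1 Ss1] := S_neq0; apply: contrapT => nS0.
have [r r0 rS] := nbhs_line s1 (open_nbhs_nbhs (conj (closed_openC S_closed) nS0)).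
apply: (rS r); first by rewrite gtr0_norm.
by rewrite add0r; exact: coneS.
Qed.

Section Scalarized.
Variable f : contlin Y R^o.
Hypothesis f_ge0 : forall k, K k -> 0 <= f k.

(** The epigraph of the perturbation function [(x, z) |-> f (F x - L x + y)],
restricted to [x] in [C] and [z] in [G x + S]; the original problem is the
section [z = 0]. *)
Definition perturbed_epi : set (X * Z * R^o) :=
  [set p | [/\ C p.1.1, epi S G p.1 &
    exists2 a, F p.1.1 = a%:E & f (a - L p.1.1 + y) <= p.2]].

Let fE a x : f (a - L x + y) = (f a : R) - (f (L x) : R) + (f y : R) :> R.
Proof. by rewrite linearD linearB. Qed.

Lemma closed_perturbed_epi :
  lower_semicontinuous (er_map f \o F : X -> \bar R) -> closed perturbed_epi.
Proof.
move=> F_lsc.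
pose H : set (X * R^o) := [set p | exists2 a, F p.1 = a%:E & f a <= p.2].
(* moving the continuous term f (L x) - f y to the other side leaves H *)
have -> : perturbed_epi =
    (fun p => p.1.1) @^-1` C `&` (fun p => p.1) @^-1` epi S G `&`
    (fun p => (p.1.1, p.2 + f (L p.1.1) - f y) : X * R^o) @^-1` H.
  apply/seteqP; split => [[[x z] r] /= [Cx Gx [a Fx far]]|].
    split => //; exists a => //=.
    by move: far; rewrite /= fE; lra.
  move=> [[x z] r] [[Cx Gx] [a Fx far]]; split => //; exists a => //.
  by move: far; rewrite /= fE; lra.
have c1 : continuous (fun p : X * Z * R^o => p.1.1).
  by move=> p; apply: (@continuous_comp (X * Z * R^o)%type (X * Z)%type X fst fst);
    exact: cvg_fst.
apply: closedI; first apply: closedI.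
- by move/continuous_closedP : c1; exact.
- have /continuous_closedP : continuous (fun p : X * Z * R^o => p.1); last exact.
  by move=> p; exact: cvg_fst.
- have /continuous_closedP : continuous
      (fun p : X * Z * R^o => (p.1.1, p.2 + f (L p.1.1) - f y) : X * R^o); last first.
    by apply; exact: lsc_epi_closed.
  apply: (@continuous_pair _ X R^o) => //.
  have cfL : continuous (fun p : X * Z * R^o => f (L p.1.1)).
    move=> p; apply: (@continuous_comp _ X R^o (fun p : X * Z * R^o => p.1.1)
      (fun x => f (L x))); first exact: c1.
    by apply: (@continuous_comp X Y R^o L f); exact: contlin_continuous.
  move=> p; apply: cvgB; last exact: cvg_cst.
  by apply: cvgD; [exact: cvg_snd|exact: cfL].
Qed.

Lemma convex_perturbed_epi : convex_set perturbed_epi.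
Proof.
apply/convex_setP => -[[x z] r] [[x' z'] r'] t t0 t1.
move=> [/= Cx Gx [a Fx far]] [/= Cx' Gx' [a' Fx' far']]; split => /=.
- by move/convex_setP : convC; apply.
- by move/convex_setP : G_convex => /(_ _ _ t t0 t1 Gx Gx').
have epiF u b : F u = b%:E -> epi K F (u, b).
  by move=> Fu; apply/epiE; exists b => //; rewrite subrr.
move/convex_setP : F_convex => /(_ _ _ t t0 t1 (epiF _ _ Fx) (epiF _ _ Fx')).
move=> /epiE[a'' Fx'' /f_ge0 /= fa'']; exists a'' => //.
have fc : f (t *: a + (1 - t) *: a' - a'') =
    t * (f a : R) + (1 - t) * (f a' : R) - (f a'' : R) :> R.
  by rewrite linearB linearD !linearZ.
have fLc : f (L (t *: x + (1 - t) *: x')) =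
    t * (f (L x) : R) + (1 - t) * (f (L x') : R) :> R.
  by rewrite [L _]linearD !linearZ [f _]linearD !linearZ.
rewrite fc in fa''; rewrite /= fE in far; rewrite /= fE in far'.
rewrite fE fLc; apply: le_trans (lerD (ler_wpM2l t0 far) (ler_wpM2l _ far')).
  lra.
by rewrite subr_ge0.
Qed.

(** The scalar form of the theorem. The functional of [approx_minorant] splits
into its parts on [X] and on [Z]; the latter is nonnegative on [S] because [z]
can move freely in the directions of [S] without leaving the epigraph of [G]. *)
Lemma approx_multiplier (s : seq X) (d eps : R) :
  lower_semicontinuous (er_map f \o F : X -> \bar R) ->
  (forall x a, feasible x -> F x = a%:E -> 0 <= f (a - L x + y)) ->
  0 < d -> 0 < eps ->
  exists (phi1 : contlin X R^o) (phi2 : contlin Z R^o),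
    [/\ {in s, forall x, `|phi1 x| <= eps}, forall z, S z -> 0 <= phi2 z &
        forall x z a, C x -> G x = z%:E -> F x = a%:E ->
          0 <= f (a - L x + y) + phi1 x + phi2 z + d].
Proof.
move=> F_lsc fF d0 eps0.
have [Cx0 Gx0] := (constraintP S C G x0).1 x0_feasible.
pose W : set (X * Z) := [set p | p.2 = 0].
have [phi phi_s phiE] : exists2 phi : contlin (X * Z)%type R^o,
    {in s, forall x, `|phi (x, 0)| <= eps} &
    forall v r, perturbed_epi (v, r) -> 0 <= r + phi v + d.
  have [] := @approx_minorant R (X * Z)%type perturbed_epi W
    [seq (x, 0) | x <- x0 :: s] (x0, 0) (f (a0 - L x0 + y)) d eps => //.
  - exact: closed_perturbed_epi.
  - exact: convex_perturbed_epi.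
  - by move=> u v t; rewrite /W /= => -> ->; rewrite scaler0 addr0.
  - by move=> _ /mapP[x _ ->].
  - move=> [x z] r; rewrite /W /= => -> [/= Cx Gx [a Fx far]].
    by apply: le_trans far; apply: fF => //; apply/constraintP.
  - exact: mem_head.
  - by split => //; exists a0.
  move=> phi [phis phiE]; exists phi => // x xs; apply: phis.
  by apply: map_f; rewrite inE xs orbT.
have [i1 i1E] := contlin_inl X Z; have [phi1 phi1E] := contlin_comp i1 phi.
have [i2 i2E] := contlin_inr X Z; have [phi2 phi2E] := contlin_comp i2 phi.
have phi12 x z : phi (x, z) = phi1 x + phi2 z.
  rewrite phi1E phi2E i1E i2E -linearD; congr (phi _).
  by apply: injective_projections; rewrite /= ?addr0 ?add0r.
exists phi1, phi2; split.
- by move=> x xs; rewrite phi1E i1E; exact: phi_s.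
- have [z0 Gz0 Sz0] := (epiE S G x0 0).1 Gx0.
  move=> z Sz.
  have [] // := @affine_ge0 R (f (a0 - L x0 + y) + phi (x0, z0) + d) (phi2 z).
  move=> t t0; have : perturbed_epi ((x0, z0 + t *: z), f (a0 - L x0 + y)).
    split => //=; last by exists a0.
    by apply/epiE; exists z0 => //; rewrite addrAC subrr add0r; exact: coneS.
  have phi2Et : phi2 (z0 + t *: z) = (phi2 z0 : R) + t * (phi2 z : R) :> R.
    by rewrite linearD linearZ.
  by move=> /phiE; rewrite !phi12 phi2Et; lra.
- move=> x z a Cx Gx Fx; have : perturbed_epi ((x, z), f (a - L x + y)).
    split => //=; last by exists a.
    by apply/epiE; exists z => //; rewrite subrr.
  by move=> /phiE; rewrite phi12 addrA.
Qed.

End Scalarized.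

(** The scalar multipliers of [approx_multiplier] are carried to [Y] by
multiplication with an interior point [e] of [K] at which the scalarizing
functional equals [1]. *)
Lemma subset_closure_lagrangian :
  (forall f : contlin Y R^o,
    lower_semicontinuous (er_map f \o F : X -> \bar R)) ->
  epi_conj K primal (L, y) ->
  closure (\bigcup_(T in Lplus S K) epi_conj K (lagrangian T)) (L, y).
Proof.
move=> F_lsc /(epi_conjE _ _ primal_proper) LyF B [[B1 B2] [/= nB1 nB2] B12].
have {}LyF x a : feasible x -> F x = a%:E -> ~ K° (L x - a - y).
  by move=> Ax Fx; apply: LyF; exact/add_indicP.
have [f [f_ge0 f_gt0 fF]] := scalarization LyF.
have [e Ke fe] : exists2 e, K° e & f e = 1.
  have [i Ki] := K_int; exists ((f i)^-1 *: i).
    by apply: interior_coneZ => //; rewrite invr_gt0 f_gt0.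
  by rewrite linearZ /= /GRing.scale /= mulVf// gt_eqF// f_gt0.
have [s [eps [eps0 sB1]]] := nbhs_contlin e nB1.
have [d d0 dB2] := nbhs_line e nB2.
have [phi1 [phi2 [phi1_s phi2_S phi_ge0]]] :=
  approx_multiplier f_ge0 s (F_lsc f) fF d0 eps0.
have [T TE] := contlin_rank1 phi2 e.
have [dL dLE] := contlin_rank1 phi1 (- e).
have [L' L'E] := contlin_add L dL.
exists (L', y + d *: e); split; last first.
  apply: B12; split; last by apply: dB2; rewrite gtr0_norm.
  apply: sB1; exists (fun x => - phi1 x); last first.
    by move=> x xs; rewrite normrN; exact: phi1_s.
  by move=> x; rewrite L'E dLE scalerN scaleNr.
exists T.
  move=> _ [z Sz <-]; rewrite TE.
  move: (phi2_S z Sz); rewrite le_eqVlt => /predU1P[<-|p0]; first by rewrite scale0r.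
  by apply: coneK => //; exact: interior_subset.
apply/(epi_conjE _ _ (lagrangian_proper T)) => x b /lagrangianP[Cx [a [z [Fx Gx ->]]]].
move=> /f_gt0; have := phi_ge0 x z a Cx Gx Fx.
rewrite L'E dLE TE !(linearB, linearD, linearZ, linearN) /=.
rewrite fe /GRing.scale /=; lra.
Qed.

End Multipliers.

Local Open Scope ereal_scope.

Theorem theorem3p7 (R : realType) (X Y Z : tvsType R)
  (hausX : hausdorff_space X) (hausY : hausdorff_space Y)
  (hausZ : hausdorff_space Z)
  (K : set Y) (K_closed : closed K) (K_convex_set : convex_set K)
  (K_cone : is_cone K) (K_pointed : pointed_cone K) (K_int : K° !=set0)
  (S : set Z) (S_neq0 : S !=set0) (S_closed : closed S)
  (S_convex_set : convex_set S) (S_cone : is_cone S)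
  (C : set X) (C_neq0 : C !=set0) (C_closed : closed C)
  (C_convex_set : convex_set C)
  (F : X -> \bar Y) (F_proper : proper_map F) (F_convex : K_convex K F)
  (F_lsc : forall ystar : contlin Y R^o,
     lower_semicontinuous (er_map ystar \o F : X -> \bar R))
  (G : X -> \bar Z) (G_proper : proper_map G) (G_convex : K_convex S G)
  (G_closed : K_epi_closed S G) :
  let A := C `&` G @^-1` (EFin @` (-%R @` S)) in
  A `&` edom F !=set0 ->
  epi_conj K (F \+ indic_map Y A) =
  closure (\bigcup_(T in Lplus S K)
    epi_conj K (F \+ indic_map Y C \+ (er_map T \o G))).
Proof.
move=> A [x0 [Ax0 domFx0]].
have [_ FNoo] := F_proper; have [_ GNoo] := G_proper.
have [K_0 _] : (K `&` -%R @` K) 0%R by rewrite K_pointed.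
have [a0 Fx0] := edom_finite FNoo domFx0.
apply/seteqP; split; last exact: closure_lagrangian_subset Ax0 Fx0.
move=> [L y] LyF; exact: (subset_closure_lagrangian K_convex_set K_cone K_0 K_int
  FNoo GNoo Ax0 Fx0 C_closed C_convex_set F_convex G_convex G_closed S_closed
  S_cone S_neq0 F_lsc LyF).
Qed.
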